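(* Let $T$ be a tree, let $\lambda: T\to(0,\infty)$ be a weight, let $1\le p<\infty$, and let $\varphi:T\to T$ be an injective self-map. Put $$\beta_\varphi=\sup_{v\in T}\frac{\lambda(v)}{\lambda(\varphi(v))}\in(0,\infty].$$ Then $C_\varphi$ is bounded on $L^p_\lambda(T)$ if and only if $\beta_\varphi$ is finite. Furthermore, in that case, $\|C_\varphi\|=\beta_\varphi^{1/p}$.
   Context: A tree $T$ is a connected, locally finite graph without cycles on a countably infinite vertex set (identified with $T$), with a fixed vertex $o$ called the root, and with no terminal vertices (a terminal vertex is one having only one neighbour). Functions on $T$ are functions on its vertices. For a weight $\lambda:T\to(0,\infty)$ and $1\le p<\infty$, $L^p_\lambda(T)$ is the Banach space of functions $f:T\to\mathbb{C}$ with $\|f\|_p=\big[\sum_{v\in T}|f(v)|^p\lambda(v)\big]^{1/p}<\infty$. For a self-map $\varphi$ of $T$, the composition operator $C_\varphi$ is $C_\varphi f(v)=f(\varphi(v))$; it is bounded on $L^p_\lambda(T)$ if it maps $L^p_\lambda(T)$ into itself and is a bounded linear operator there, and $\|C_\varphi\|$ is then its operator norm. *)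

(* Defs.v *)
From HB Require Import structures.
From mathcomp Require Import all_boot all_order all_algebra.
From mathcomp Require Import complex.
From mathcomp Require Import all_classical all_reals all_analysis.

Set Implicit Arguments.
Unset Strict Implicit.
Unset Printing Implicit Defensive.

Import Order.TTheory GRing.Theory Num.Theory.

Local Open Scope classical_set_scope.
Local Open Scope ring_scope.
Local Open Scope complex_scope.

Record tree := Tree {
  vertex :> choiceType;
  adj : rel vertex;
  tree_root : vertex;
  card_vertex : ([set: vertex] #= [set: nat])%card;
  adj_sym : symmetric adj;
  adj_irrefl : irreflexive adj;
  tree_connected : forall x y, exists2 s, path adj x s & last x s = y;
  tree_locally_finite : forall x, finite_set [set y | adj x y];
  (* The bound on the size excludes the back-and-forth walk x, y, x along an
     edge, which satisfies ucycle. *)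
  tree_acyclic : forall c : seq vertex, (2 < size c)%N -> ~ ucycle adj c;
  tree_no_terminal : forall x y, [set z | adj x z] <> [set y]
}.

Section WeightedLp.
Context {R : realType} {T : tree}.
Implicit Types (p : R) (lambda : T -> R) (f g : T -> R[i]).
Implicit Types A : (T -> R[i]) -> (T -> R[i]).

Local Open Scope ereal_scope.

(* Extended-real valued: it is +oo exactly when the sum diverges.
   Normc.normc is the modulus of a complex number as an element of R. *)
Definition Lp_norm p lambda f : \bar R :=
  (\esum_(v in [set: T]) (Normc.normc (f v) `^ p * lambda v)%:E) `^ p^-1.

Definition Lp p lambda : set (T -> R[i]) := [set f | Lp_norm p lambda f < +oo].

Definition bounded_on_Lp p lambda A : Prop :=
  [/\ forall f, Lp p lambda f -> Lp p lambda (A f),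
      forall (a : R[i]) f g, Lp p lambda f -> Lp p lambda g ->
        A (a \*o f \+ g)%R = (a \*o A f \+ A g)%R
    & exists M : R, forall f, Lp p lambda f ->
        Lp_norm p lambda (A f) <= M%:E * Lp_norm p lambda f].

Definition operator_norm p lambda A : \bar R :=
  ereal_sup [set Lp_norm p lambda (A f) | f in
    [set f | Lp p lambda f /\ Lp_norm p lambda f <= 1]].

Definition composition_operator (phi : T -> T) : (T -> R[i]) -> (T -> R[i]) :=
  fun f v => f (phi v).

Definition beta lambda (phi : T -> T) : \bar R :=
  ereal_sup [set (lambda v / lambda (phi v))%:E | v in [set: T]].

End WeightedLp.

(* Main.v *)
Require Import Defs.
From HB Require Import structures.
From mathcomp Require Import all_boot all_order all_algebra.
From mathcomp Require Import complex.
From mathcomp Require Import all_classical all_reals all_analysis.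

Import Order.TTheory GRing.Theory Num.Theory.

Local Open Scope ring_scope.
Local Open Scope ereal_scope.

(** Since phi is injective, reindexing along phi bounds ||C_phi f||^p, the sum
    of |f(phi v)|^p lambda(v), by beta times the sum of |f|^p lambda over the
    range of phi, whence ||C_phi|| <= beta^(1/p).  Conversely C_phi sends the
    normalized point mass at phi v to a multiple of the point mass at v whose
    norm is (lambda v / lambda (phi v))^(1/p).  Both bounds hold in [0, +oo],
    so ||C_phi|| = beta^(1/p) without any finiteness assumption, and
    boundedness is the finiteness of this common value. *)

(** Each finite partial sum scales exactly and is at most the full sum; [b] may be [+oo]. *)
Lemma esumZl_le (R : realType) (I : choiceType) (D : set I) (b : \bar R)
    (a : I -> \bar R) : 0 <= b -> (forall i, 0 <= a i) ->
  \esum_(i in D) (b * a i) <= b * \esum_(i in D) a i.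
Proof.
move=> b0 a0; apply: ge_ereal_sup => _ [X DX <-].
rewrite -ge0_mule_fsumr//; apply: lee_wpmul2l => //.
by apply: esum_ge; exists X.
Qed.

Lemma ge0_ler_poweR (R : realType) (r : R) (x y : \bar R) : (0 <= r)%R ->
  0 <= x -> x <= y -> x `^ r <= y `^ r.
Proof.
move=> r0 x0 xy; apply: gt0_ler_poweR => //; rewrite in_itv/= ?leey ?andbT//.
exact: le_trans xy.
Qed.

Lemma normc_real (R : realType) (x : R) : Normc.normc (x%:C)%C = `|x|%R.
Proof. by rewrite /Normc.normc /= expr0n addr0 sqrtr_sqr. Qed.

Definition point_mass {R : realType} {T : tree} (w : T) (c : R) : T -> R[i] :=
  fun v => if v == w then (c%:C)%C else 0%R.

Section CompositionOperator.
Context {R : realType} {T : tree}.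
Variables (lambda : T -> R) (p : R) (phi : T -> T).
Hypotheses (lambda_gt0 : forall v, (0 < lambda v)%R) (p_ge1 : (1 <= p)%R).

Let p_gt0 : (0 < p)%R. Proof. exact: lt_le_trans p_ge1. Qed.
Let p_neq0 : p != 0%R. Proof. exact: lt0r_neq0. Qed.
Let pV_ge0 : (0 <= p^-1)%R. Proof. by rewrite invr_ge0 ltW. Qed.

Local Notation C := (composition_operator phi).

Lemma le_beta v : (lambda v / lambda (phi v))%:E <= beta lambda phi.
Proof. by apply: ereal_sup_ubound; exists v. Qed.

Lemma beta_gt0 : 0 < beta lambda phi.
Proof.
(* The root serves as a witness that the supremum runs over a nonempty set. *)
by apply: lt_le_trans (le_beta (tree_root T)); rewrite lte_fin divr_gt0.
Qed.

Lemma Lp_norm_ge0 (f : T -> R[i]) : 0 <= Lp_norm p lambda f.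
Proof. exact: poweR_ge0. Qed.

Lemma Lp_norm_point_mass (w : T) (c : R) : (0 <= c)%R ->
  Lp_norm p lambda (point_mass w c) = ((c `^ p * lambda w) `^ p^-1)%:E.
Proof.
move=> c0; rewrite -poweR_EFin /Lp_norm; congr (_ `^ _).
rewrite -[RHS](@esum_set1 _ _ w (fun v => (c `^ p * lambda v)%:E)); last first.
  by rewrite lee_fin mulr_ge0 ?powR_ge0 ?ltW.
rewrite esum_mkcond [RHS]esum_mkcond; apply: eq_esum => v _.
rewrite in_setT in_set1 /point_mass.
case: eqP => _; first by rewrite normc_real ger0_norm.
(* Off [w] the term vanishes because [p] is nonzero; the power of 0 with exponent 0 would be 1. *)
by rewrite Normc.normc0 powR0// mul0r.
Qed.

Lemma Lp_norm_composition_le (phi_inj : injective phi) (f : T -> R[i]) :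
  Lp_norm p lambda (C f) <= beta lambda phi `^ p^-1 * Lp_norm p lambda f.
Proof.
pose a v := (Normc.normc (f v) `^ p * lambda v)%:E.
have a_ge0 v : 0 <= a v by rewrite lee_fin mulr_ge0 ?powR_ge0 ?ltW.
rewrite /Lp_norm -poweRM ?(ltW beta_gt0)//; last first.
  by apply: esum_ge0 => v _; exact: a_ge0.
apply: ge0_ler_poweR => //.
  by apply: esum_ge0 => v _; rewrite lee_fin mulr_ge0 ?powR_ge0 ?ltW.
apply: (@le_trans _ _ (\esum_(v in [set: T]) (beta lambda phi * a (phi v)))).
  (* Termwise, [lambda v] is the ratio at [v] times [lambda (phi v)]. *)
  apply: le_esum => v _; apply: le_trans (lee_wpmul2r (a_ge0 _) (le_beta v)).
  rewrite -EFinM lee_fin mulrCA -[X in (_ <= _ * X)%R]mulrA mulVf ?mulr1//.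
  exact: lt0r_neq0.
apply: le_trans.
  by apply: esumZl_le => //; exact: ltW beta_gt0.
apply: lee_wpmul2l; first exact: ltW beta_gt0.
(* By injectivity no vertex of the range is counted twice; the sum over the range then grows to the
   sum over all of [T]. *)
rewrite -(@esum_image _ _ _ _ _ a); last by move=> x y _ _; exact: phi_inj.
rewrite esum_mkcond; apply: le_esum => v _.
by case: ifP => // _; exact: a_ge0.
Qed.

Lemma operator_norm_composition (phi_inj : injective phi) :
  operator_norm p lambda C = beta lambda phi `^ p^-1.
Proof.
apply/eqP; rewrite eq_le; apply/andP; split.
  apply: ge_ereal_sup => _ [f [_ f1] <-].
  apply: le_trans (Lp_norm_composition_le phi_inj f) _.
  by rewrite -[leRHS]mule1; apply: lee_wpmul2l => //; exact: poweR_ge0.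
have ratio_le v :
    (lambda v / lambda (phi v))%:E `^ p^-1 <= operator_norm p lambda C.
  (* Chosen so that [c] to the power [p] cancels the weight at [phi v], giving the point mass norm
     1. *)
  pose c := ((lambda (phi v))^-1 `^ p^-1)%R.
  have cp : (c `^ p = (lambda (phi v))^-1)%R.
    by rewrite -powRrM mulVf// powRr1// invr_ge0 ltW.
  have norm1 : Lp_norm p lambda (point_mass (phi v) c) = 1.
    rewrite Lp_norm_point_mass ?powR_ge0// cp mulVf ?powR1//.
    exact: lt0r_neq0.
  have Cc : C (point_mass (phi v) c) = point_mass v c.
    by apply/funext => u; rewrite /composition_operator /point_mass inj_eq.
  apply: ereal_sup_ubound; exists (point_mass (phi v) c).
    by rewrite /Lp /= norm1 ltry.
  by rewrite Cc Lp_norm_point_mass ?powR_ge0// cp mulrC.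
have norm_ge0 : 0 <= operator_norm p lambda C.
  by apply: le_trans (ratio_le (tree_root T)); exact: poweR_ge0.
(* Writing the norm as the [p^-1]-th power of its [p]-th power strips the root from [beta], so that
   the supremum can be bounded term by term. *)
rewrite -[leRHS]poweRe1// -(divff p_neq0) poweRrM.
apply: ge0_ler_poweR => //; first exact: ltW beta_gt0.
apply: ge_ereal_sup => _ [v _ <-].
have ratio_ge0 : 0 <= (lambda v / lambda (phi v))%:E.
  by rewrite lee_fin divr_ge0 ?ltW.
rewrite -[leLHS]poweRe1// -(mulVf p_neq0) poweRrM.
apply: ge0_ler_poweR (ratio_le v); [exact: ltW | exact: poweR_ge0].
Qed.

Lemma bounded_operator_norm_lty (A : (T -> R[i]) -> (T -> R[i])) :
  bounded_on_Lp p lambda A -> operator_norm p lambda A < +oo.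
Proof.
(* The sign of [M] is unspecified, whereas multiplying [Lp_norm p lambda f <= 1] by a constant
   requires it to be nonnegative; hence the absolute value. *)
move=> [_ _ [M AM]]; apply: le_lt_trans (ltry `|M|%R).
apply: ge_ereal_sup => _ [f [Lf f1] <-]; apply: le_trans (AM f Lf) _.
apply: (@le_trans _ _ (`|M|%:E * Lp_norm p lambda f)).
  by apply: lee_wpmul2r; rewrite ?Lp_norm_ge0// lee_fin ler_norm.
by rewrite -[leRHS]mule1; apply: lee_wpmul2l.
Qed.

Lemma bounded_composition (phi_inj : injective phi) :
  beta lambda phi < +oo -> bounded_on_Lp p lambda C.
Proof.
move=> beta_lty.
have norm_fin : beta lambda phi `^ p^-1 \is a fin_num.
  by rewrite ge0_fin_numE ?poweR_ge0// poweR_lty.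
split=> //.
- move=> f Lf; apply: le_lt_trans (Lp_norm_composition_le phi_inj f) _.
  by rewrite lte_mul_pinfty ?poweR_ge0.
- exists (fine (beta lambda phi `^ p^-1)) => f _; rewrite fineK//.
  exact: Lp_norm_composition_le.
Qed.

End CompositionOperator.

Theorem theorem3p1 (R : realType) (T : tree) (lambda : T -> R)
    (lambda_gt0 : forall v, (0 < lambda v)%R) (p : R) (p_ge1 : (1 <= p)%R)
    (phi : T -> T) (phi_inj : injective phi) :
  [/\ 0 < beta lambda phi,
      bounded_on_Lp p lambda (composition_operator phi)
        <-> beta lambda phi < +oo
    & bounded_on_Lp p lambda (composition_operator phi) ->
        operator_norm p lambda (composition_operator phi)
          = beta lambda phi `^ p^-1].
Proof.
split; first exact: beta_gt0.
- split; last exact: bounded_composition.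
  move=> /bounded_operator_norm_lty; rewrite operator_norm_composition//.
  (* Finiteness of the power passes to [beta] because the exponent is nonzero: [+oo] to the power 0
     is 1. *)
  by apply: lty_poweRy; rewrite invr_neq0// lt0r_neq0// (lt_le_trans _ p_ge1).
- by move=> _; exact: operator_norm_composition.
Qed.
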